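(* Let $m \geq 3$ be an integer. Then $g(m,4) = 10m-9$.
   Context: For positive integers $m$ and $r$, $g(m,r)$ denotes the least positive integer $N$ such that for every map $\Delta:\{1,2,\ldots,N\}\to\{1,2,\ldots,r\}$ there exist $2m$ integers $x_1<\cdots<x_m<y_1<\cdots<y_m$ in $\{1,\ldots,N\}$ with $\Delta(x_1)=\cdots=\Delta(x_m)$, $\Delta(y_1)=\cdots=\Delta(y_m)$, and $2(x_m-x_1)\leq y_m-x_1$. *)

(* Defs.v *)
From mathcomp Require Import all_boot.
From mathcomp Require Import boolp classical_sets.
Set Implicit Arguments.
Unset Strict Implicit.
Unset Printing Implicit Defensive.

Local Open Scope nat_scope.
Local Open Scope classical_set_scope.

(* [x = [:: x_1; ...; x_m]] and [y = [:: y_1; ...; y_m]]; for [0 < m], [head]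
   and [last] are the first and last terms and the truncated subtractions are
   exact because [x ++ y] is increasing. *)
Definition good_pair (m N : nat) (Delta : nat -> nat) (x y : seq nat) : Prop :=
  [/\ size x = m /\ size y = m,
      sorted ltn (x ++ y),
      {in x ++ y, forall i, 1 <= i <= N},
      constant (map Delta x) /\ constant (map Delta y)
    & 2 * (last 0 x - head 0 x) <= last 0 y - head 0 x].

(* Only the values of [Delta] on {1, ..., N} matter. *)
Definition forces (m r N : nat) : Prop :=
  forall Delta : nat -> nat,
    (forall i, 1 <= i <= N -> 1 <= Delta i <= r) ->
    exists x y : seq nat, good_pair m N Delta x y.

Definition is_least_forcing (m r N : nat) : Prop :=
  [/\ 0 < N, forces m r N & forall N', 0 < N' -> forces m r N' -> N <= N'].

(* The default value 0 is never a least forcing integer, so [g m r = N] with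
   [0 < N] does assert that the minimum exists and equals [N]. *)
Definition g (m r : nat) : nat := xget 0 [set N | is_least_forcing m r N].

Lemma gE (m r N : nat) : 0 < N -> g m r = N <-> is_least_forcing m r N.
Proof.
move=> N0; split=> [|hN].
  by rewrite /g; case: xgetP => [M _ hM <- //|_ N_eq0]; rewrite -N_eq0 in N0.
apply: xget_unique => // M [M0 fM minM]; case: hN => _ fN minN.
by apply/eqP; rewrite eqn_leq minM ?minN.
Qed.

(* Main.v *)
Require Import Defs.
From mathcomp Require Import all_boot.
From mathcomp Require Import zify.

(** Write [N = 10 m - 9].  Upper bound: the first [4 m - 3] integers contain a
    monochromatic [m]-set [X].  Let [p] be the last integer whose colour occurs
    at least [m] times in [[4 m - 2, N]], and let [Y] be the last [m] integers
    of that colour.  If [8 m - 7 <= p], then [X, Y] works.  Otherwise the more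
    than [2 m - 2] integers beyond [p] need three colours that are rare in
    [[4 m - 2, N]], so all but at most [m - 2] of the integers in
    [[4 m - 2, p]] have the colour of [p], and the first and last [m] integers
    of that colour work.

    Lower bound: with [k = m - 1], the colouring
    [1^k 2^k 3^k 4^k 1^k 2^k 1^(2k) 3^k 4^k] of [[1, 10 k]] has no good pair. *)

(** Being a subsequence of [iota 1 N] yields both the ordering and the range condition. *)
Lemma good_pair_subseq (m N : nat) (Delta : nat -> nat) (c d : nat) (x y : seq nat) :
  size x = m -> size y = m -> subseq (x ++ y) (iota 1 N) ->
  {in x, forall i, Delta i = c} -> {in y, forall i, Delta i = d} ->
  2 * (last 0 x - head 0 x) <= last 0 y - head 0 x ->
  good_pair m N Delta x y.
Proof.
move=> sx sy sub cx cy hd.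
have cst z e : {in z, forall i, Delta i = e} -> constant (map Delta z).
  move=> cz; apply: (@all_pred1_constant _ e); rewrite all_map.
  by apply/allP=> i /cz /= ->.
split=> //.
- exact: subseq_sorted ltn_trans _ _ sub (iota_ltn_sorted 1 N).
- by move=> i /(mem_subseq sub); rewrite mem_iota; lia.
- by split; [exact: cst cx | exact: cst cy].
Qed.

Lemma nth_sorted_ltn_gap (s : seq nat) (i j : nat) :
  sorted ltn s -> i <= j < size s -> nth 0 s i + (j - i) <= nth 0 s j.
Proof.
move=> ss /andP[]; elim: j => [|j IHj] lij ljs.
  by have -> : i = 0; lia.
have [->|nij] := eqVneq i j.+1; first by rewrite subnn addn0.
have := IHj ltac:(lia) ltac:(lia).
suff : nth 0 s j < nth 0 s j.+1 by lia.
by apply: (sorted_ltn_nth ltn_trans) => //; rewrite inE; lia.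
Qed.

Lemma size_count_colors4 (Delta : nat -> nat) (s : seq nat) :
  {in s, forall i, 1 <= Delta i <= 4} ->
  size s = count (fun i => Delta i == 1) s + count (fun i => Delta i == 2) s
         + count (fun i => Delta i == 3) s + count (fun i => Delta i == 4) s.
Proof.
elim: s => [//|a s IHs] hs /=.
rewrite (IHs _); last by move=> i si; apply: hs; rewrite inE si orbT.
have := hs a (mem_head _ _).
by case: (Delta a) => [|[|[|[|[|n]]]]] //=; lia.
Qed.

Lemma nth_filter_iota_lt (P : pred nat) (a n i : nat) :
  i < count P (iota a n) -> nth 0 (filter P (iota a n)) i < a + n.
Proof.
rewrite -size_filter => /(mem_nth 0).
by rewrite mem_filter mem_iota => /andP[_ /andP[]].
Qed.

(** * Upper bound by pigeonhole *)

Lemma forces4_10m9 (m : nat) : 3 <= m -> forces m 4 (10 * m - 9).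
Proof.
move=> hm Delta hD; set N := 10 * m - 9.
pose col c := [pred i | Delta i == c].
have sum4 a n : 0 < a -> a + n <= N.+1 ->
    n = count (col 1) (iota a n) + count (col 2) (iota a n)
      + count (col 3) (iota a n) + count (col 4) (iota a n).
  move=> a0 an; rewrite -[LHS](size_iota a) (@size_count_colors4 Delta) //.
  by move=> i; rewrite mem_iota => hi; apply: hD; lia.
have pigeon a n : 0 < a -> a + n <= N.+1 -> 4 * m - 3 <= n ->
    exists c, m <= count (col c) (iota a n).
  move=> a0 an hn; have := sum4 a n a0 an.
  have [|h1] := leqP m (count (col 1) (iota a n)); first by exists 1.
  have [|h2] := leqP m (count (col 2) (iota a n)); first by exists 2.
  have [|h3] := leqP m (count (col 3) (iota a n)); first by exists 3.
  by exists 4; lia.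
pose T (c : nat) : seq nat := filter (col c) (iota (4 * m - 2) (6 * m - 6)).
have memT d i : i < size (T d) -> nth 0 (T d) i \in T d by exact: mem_nth.
have iotaN : iota 1 N = iota 1 (4 * m - 3) ++ iota (4 * m - 2) (6 * m - 6).
  rewrite (_ : 4 * m - 2 = 1 + (4 * m - 3)); last by lia.
  by rewrite -iotaD; congr iota; rewrite /N; lia.
pose big i := (4 * m - 2 <= i <= N) && (m <= size (T (Delta i))).
have exbig : exists i, big i.
  have [c hc] : exists c, m <= size (T c).
    have [c] := pigeon (4 * m - 2) (6 * m - 6) ltac:(lia) ltac:(rewrite /N; lia) ltac:(lia).
    by rewrite -size_filter; exists c.
  have : nth 0 (T c) 0 \in T c by apply: memT; lia.
  rewrite mem_filter mem_iota /= => /andP[/eqP hcol hr].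
  by exists (nth 0 (T c) 0); rewrite /big hcol hc /N; lia.
have bigN i : big i -> i <= N by rewrite /big; lia.
case: (ex_maxnP exbig bigN) => p /andP[pr pbig] pmax.
set c := Delta p in pbig.
have pT : p \in T c by rewrite mem_filter /= eqxx mem_iota; move: pr; rewrite /N; lia.
have sT : sorted ltn (T c).
  by apply: (subseq_sorted ltn_trans (filter_subseq _ _)); exact: iota_ltn_sorted.
(* The last term of [T c] is itself [big], hence at most [p] by maximality; it is at least [p]
   because [p] occurs in [T c]. *)
have lastT : nth 0 (T c) (size (T c)).-1 = p.
  have sz0 : 0 < size (T c) by lia.
  apply/eqP; rewrite eqn_leq; apply/andP; split.
    have : nth 0 (T c) (size (T c)).-1 \in T c by apply: memT; lia.
    rewrite mem_filter mem_iota /= => /andP[/eqP hcol hr].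
    by apply: pmax; rewrite /big hcol pbig /N; lia.
  have := @nth_sorted_ltn_gap (T c) (index p (T c)) (size (T c)).-1 sT.
  rewrite nth_index // => h.
  have ip : index p (T c) < size (T c) by rewrite index_mem.
  have := h ltac:(lia); lia.
pose y := drop (size (T c) - m) (T c).
have sy : size y = m by rewrite size_drop; lia.
have lasty : last 0 y = p.
  rewrite -nth_last sy nth_drop -lastT; congr nth; lia.
have cT : {in T c, forall i, Delta i = c}.
  by move=> i; rewrite mem_filter => /andP[/eqP].
have cy : {in y, forall i, Delta i = c} by move=> i /mem_drop; exact: cT.
(* The threshold comes from [X] in [[1, 4 * m - 3]]: there
   [2 * x_m - x_1 <= 2 * (4 * m - 3) - 1]. *)
have [p8|p8] := leqP (8 * m - 7) p.
  have [d hd] := pigeon 1 (4 * m - 3) ltac:(lia) ltac:(rewrite /N; lia) ltac:(lia).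
  pose S : seq nat := filter (col d) (iota 1 (4 * m - 3)).
  have sS : m <= size S by rewrite size_filter.
  exists (take m S), y.
  have szx : size (take m S) = m by rewrite size_takel.
  apply: (@good_pair_subseq _ _ _ d c) => //.
  - rewrite iotaN; apply: cat_subseq.
      exact: subseq_trans (take_subseq _ _) (filter_subseq _ _).
    exact: subseq_trans (drop_subseq _ _) (filter_subseq _ _).
  - by move=> i /mem_take; rewrite mem_filter => /andP[/eqP].
  rewrite lasty -nth_last szx -nth0 !nth_take; try lia.
  have h1 : nth 0 S m.-1 < 1 + (4 * m - 3) by apply: nth_filter_iota_lt; lia.
  have : nth 0 S 0 \in S by apply/mem_nth/(leq_trans _ sS); lia.
  by rewrite mem_filter mem_iota => /andP[_ /andP[h2 _]]; lia.
pose A d := count (col d) (iota (4 * m - 2) (p - (4 * m - 3))).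
pose B d := count (col d) (iota p.+1 (N - p)).
have AB d : size (T d) = A d + B d.
  rewrite size_filter /A /B -count_cat.
  rewrite (_ : p.+1 = 4 * m - 2 + (p - (4 * m - 3))); last by lia.
  by rewrite -iotaD; congr (count _ (iota _ _)); rewrite /N; lia.
(* A frequent colour met beyond [p] would contradict the maximality of [p]. *)
have Bbig d : m <= size (T d) -> B d = 0.
  move=> hd; apply/eqP; rewrite -leqn0 leqNgt -has_count; apply/hasPn => i.
  rewrite mem_iota => hi; apply/negP => /= /eqP di.
  by have := pmax i; rewrite /big di hd /N; move: hi; rewrite /N; lia.
have sumA := sum4 (4 * m - 2) (p - (4 * m - 3)) ltac:(lia) ltac:(rewrite /N; lia).
have sumB := sum4 p.+1 (N - p) ltac:(lia) ltac:(rewrite /N; lia).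
rewrite -/(A 1) -/(A 2) -/(A 3) -/(A 4) in sumA.
rewrite -/(B 1) -/(B 2) -/(B 3) -/(B 4) in sumB.
(* Rare colours have at most [m - 1] terms each, so the at least [2 * m - 1] integers beyond [p] use
   all three colours other than [c]. These total at most [3 * m - 3] of the [6 * m - 6] terms, and
   at most [m - 2] of them lie before [p]. *)
have [hA few] : 3 * m - 3 <= A c /\ p - (4 * m - 3) <= A c + (m - 2).
  have Bc := Bbig c pbig.
  have := (AB 1, AB 2, AB 3, AB 4, Bbig 1, Bbig 2, Bbig 3, Bbig 4).
  move=> [[[[[[[a1 a2] a3] a4] b1] b2] b3] b4].
  have := hD p ltac:(lia); rewrite -/c; move: pbig Bc (AB c).
  move: pr sumA sumB; rewrite /N.
  by case: (c) => [|[|[|[|[|n]]]]]; lia.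
have sTA : size (T c) = A c by rewrite AB Bbig // addn0.
pose x := take m (T c).
have sx : size x = m by rewrite size_takel.
exists x, y; apply: (@good_pair_subseq _ _ _ c c) => //.
- rewrite iotaN; apply: subseq_trans (suffix_subseq _ _).
  apply: subseq_trans (filter_subseq (col c) _).
  rewrite -[X in subseq _ X](cat_take_drop m (T c)).
  apply: cat_subseq => //; rewrite /y.
  (* The first and last [m] terms are disjoint: [2 * m <= 3 * m - 3] as [m >= 3]. *)
  rewrite (_ : size (T c) - m = (size (T c) - m - m) + m); last by lia.
  by rewrite -drop_drop; exact: drop_subseq.
- by move=> i /mem_take; exact: cT.
rewrite lasty -nth_last sx -nth0 !nth_take; try lia.
have h0 : 4 * m - 2 <= nth 0 (T c) 0.
  have : nth 0 (T c) 0 \in T c by apply: memT; lia.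
  by rewrite mem_filter mem_iota => /andP[_ /andP[]].
(* At most [m - 2] of the [2 * m - 2] integers in [[4 * m - 2, 6 * m - 5]] miss the colour [c],
   leaving [m]. *)
have h1 : nth 0 (T c) m.-1 <= 6 * m - 5.
  have E2 : iota (4 * m - 2) (p - (4 * m - 3)) =
      iota (4 * m - 2) (2 * m - 2) ++ iota (6 * m - 4) (p - (6 * m - 5)).
    rewrite (_ : 6 * m - 4 = 4 * m - 2 + (2 * m - 2)); last by lia.
    rewrite -iotaD; congr iota.
    have : A c <= p - (4 * m - 3) by rewrite /A -[X in _ <= X](size_iota (4 * m - 2)) count_size.
    lia.
  have E3 : iota (4 * m - 2) (6 * m - 6) =
      iota (4 * m - 2) (2 * m - 2) ++ iota (6 * m - 4) (4 * m - 4).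
    rewrite (_ : 6 * m - 4 = 4 * m - 2 + (2 * m - 2)); last by lia.
    by rewrite -iotaD; congr iota; lia.
  have hcnt : m <= count (col c) (iota (4 * m - 2) (2 * m - 2)).
    have := count_size (col c) (iota (6 * m - 4) (p - (6 * m - 5))).
    move: hA few; rewrite /A E2 count_cat size_iota; lia.
  rewrite /T E3 filter_cat nth_cat size_filter ifT; last by lia.
  have := @nth_filter_iota_lt (col c) (4 * m - 2) (2 * m - 2) m.-1; lia.
(* At least [2 * m - 3] terms follow [x_m], so [p - x_m >= 2 * m - 3 >= x_m - x_1]. *)
have := @nth_sorted_ltn_gap (T c) m.-1 (size (T c)).-1 sT ltac:(lia).
by rewrite lastT; lia.
Qed.

(** * Lower bound by an explicit colouring *)

Definition bad_coloring (k i : nat) : nat :=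
  if i <= k then 1 else if i <= 2 * k then 2 else if i <= 3 * k then 3
  else if i <= 4 * k then 4 else if i <= 5 * k then 1 else if i <= 6 * k then 2
  else if i <= 8 * k then 1 else if i <= 9 * k then 3 else 4.

(* The number of [i] in [[1, n]] with [bad_coloring k i = c]: each truncated
   difference counts one block. *)
Definition bad_count (k c n : nat) : nat :=
  match c with
  | 1 => minn n k + (minn n (5 * k) - 4 * k) + (minn n (8 * k) - 6 * k)
  | 2 => (minn n (2 * k) - k) + (minn n (6 * k) - 5 * k)
  | 3 => (minn n (3 * k) - 2 * k) + (minn n (9 * k) - 8 * k)
  | _ => (minn n (4 * k) - 3 * k) + (n - 9 * k)
  end.

Lemma bad_coloring_bounds (k i : nat) : 1 <= bad_coloring k i <= 4.
Proof. by rewrite /bad_coloring; do !case: ifP. Qed.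

Lemma bad_count_ltn (k i j : nat) :
  i < j -> bad_count k (bad_coloring k j) i < bad_count k (bad_coloring k j) j.
Proof.
by move=> ij; rewrite /bad_coloring; do !case: ifP => ?; rewrite /bad_count; lia.
Qed.

(** This turns a monochromatic set into a piecewise linear inequality between its two ends, which
    [lia] settles block by block. *)
Lemma bad_count_path (k c a : nat) (s : seq nat) :
  path ltn a s -> {in s, forall i, bad_coloring k i = c} ->
  bad_count k c a + size s <= bad_count k c (last a s).
Proof.
elim: s a => [|b s IHs] a /=; first by rewrite addn0.
move=> /andP[ab bs] cs.
have : {in s, forall i, bad_coloring k i = c}.
  by move=> i si; apply: cs; rewrite inE si orbT.
move=> /(IHs b bs).
by have := @bad_count_ltn k a b ab; rewrite (cs b (mem_head _ _)); lia.
Qed.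

(** A good pair needs [2 * x_m - x_1 <= y_m], but counting colours forces
    [y_m <= 8 * k < 2 * x_m - x_1]. *)
Lemma bad_coloring_no_pair (k N : nat) (x y : seq nat) :
  0 < k -> N <= 10 * k -> ~ good_pair k.+1 N (bad_coloring k) x y.
Proof.
move=> k0 hN [[sx sy] sxy rxy [cx cy] hd].
case: x sx sxy rxy cx hd => [//|x1 x] /= [sx].
case: y sy cy => [//|y1 y] /= [sy].
rewrite cat_path /= => cy /and3P[px xy py] rxy cx hd.
have col a s : all (pred1 (bad_coloring k a)) (map (bad_coloring k) s) ->
    {in s, forall i, bad_coloring k i = bad_coloring k a}.
  by rewrite all_map => /allP h i /h /eqP.
have hx := @bad_count_path _ _ _ _ px (col _ _ cx).
have hy := @bad_count_path _ _ _ _ py (col _ _ cy).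
have x1r := rxy x1 (mem_head _ _).
have yr : last y1 y <= 10 * k.
  have : last y1 y \in x1 :: x ++ y1 :: y by rewrite inE mem_cat mem_last !orbT.
  by move=> /rxy; lia.
have cyl : bad_coloring k (last y1 y) = bad_coloring k y1.
  by have := mem_last y1 y; rewrite inE => /predU1P[-> //|/(col _ _ cy)].
move: (last x1 x) (last y1 y) sx sy hx hy xy hd x1r yr cyl.
move=> x2 y2 -> -> {px py}hx hy xy hd x1r yr cyl.
(* Each colour has only [k] integers in [[1, 4 * k]], one too few for [x]. *)
have x2_gt : 4 * k < x2.
  move: hx {hy hd cyl}; rewrite /bad_coloring.
  by do !case: ifP => ?; rewrite /bad_count; lia.
have y1_gt : 4 * k < y1 by lia.
(* Colours 3 and 4 have only [k] integers each in [[4 * k + 1, 10 * k]]. *)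
have cy1 : bad_coloring k y1 \in [:: 1; 2].
  move: hy {hx hd cyl x2_gt xy}; rewrite /bad_coloring !inE.
  by do !case: ifP => // ?; rewrite /bad_count; lia.
have y2_le : y2 <= 8 * k.
  move: cy1; rewrite -cyl {hx hy hd cyl}/bad_coloring.
  by do !case: ifP => //; lia.
have y1_le : y1 + k <= y2.
  move: hy {hx hd cyl x2_gt xy}; rewrite !inE in cy1.
  by case/orP: cy1 => /eqP ->; rewrite /bad_count; lia.
(* For instance, [x1] in one of the first two blocks gives [x2 >= x1 + 4 * k], so
   [2 * x2 - x1 > 8 * k]. *)
move: hx {hy cy1 cyl}; rewrite /bad_coloring.
by do !case: ifP => ?; rewrite /bad_count; lia.
Qed.

Theorem theorem3p5 (m : nat) (hm : 3 <= m) : g m 4 = 10 * m - 9.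
Proof.
apply/gE; first by lia.
split; [by lia | exact: forces4_10m9 |].
(* With [k = m - 1], [N < 10 * m - 9] means [N <= 10 * k]. *)
move=> N N0 hN; rewrite leqNgt; apply/negP => ltN.
have [i _|x [y]] := hN (bad_coloring m.-1); first exact: bad_coloring_bounds.
rewrite -[X in good_pair X](_ : m.-1.+1 = m); last by lia.
by apply: bad_coloring_no_pair; lia.
Qed.
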